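(* Let $n\ge 3$ and $2\le k\le n$ be integers. Let $N:=\binom{n}{2}$ and define $$\mu:=\frac{\binom{k}{2}\binom{n}{3}}{\binom{N}{2}},$$ $$d_1:=\frac{\binom{n}{3}}{\binom{N}{2}}+\frac{13-12k+3k^2}{\binom{N}{2}}+\left(1-\frac{13-12k+3k^2}{\binom{N}{2}}\right)\left(\frac{4(k-2)\binom{n}{3}}{\binom{N}{2}}+\frac{6\binom{n}{4}(k-2)}{\binom{n}{3}(N-2)}\right),$$ $$d_2:=\frac{2\binom{n}{3}}{\binom{N}{2}}+\frac{13-12k+3k^2}{\binom{N}{2}}+\left(1-\frac{13-12k+3k^2}{\binom{N}{2}}\right)\left(\frac{8(k-2)\binom{n}{3}}{\binom{N}{2}}+\frac{6\binom{n}{4}(k-2)}{\binom{n}{3}(N-2)}+\frac{k-2}{N-2}\left(\frac{5n-11}{4}\right)\right),$$ $$D^{(1)}_{n,k}:=\min(d_1,\ \mu\, d_1,\ 1),\qquad D^{(2)}_{n,k}:=\min(d_2,\ 2\mu\, d_2,\ 1).$$ Then $$\binom{N}{k}e^{-2\mu}\left(1-e^{2\mu}D^{(2)}_{n,k}\right)\le S(n,n-k)\le\binom{N}{k}e^{-2\mu}\left(1+e^{2\mu}D^{(2)}_{n,k}\right),$$ $$\binom{N}{k}e^{-\mu}\left(1-e^{\mu}D^{(1)}_{n,k}\right)\le |s(n,n-k)|\le\binom{N}{k}e^{-\mu}\left(1+e^{\mu}D^{(1)}_{n,k}\right).$$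
   Context: $s(n,m)$ and $S(n,m)$ denote the (signed) Stirling numbers of the first kind and the Stirling numbers of the second kind, defined by $\sum_{m=0}^n s(n,m)x^m=(x)_n$ and $\sum_{m=0}^n S(n,m)(x)_m=x^n$, where $(x)_n=x(x-1)\cdots(x-n+1)$ is the falling factorial. Thus $|s(n,m)|$ counts permutations of $n$ elements with exactly $m$ cycles and $S(n,m)$ counts partitions of an $n$-element set into exactly $m$ non-empty blocks. Binomial coefficients $\binom{a}{b}$ with $0\le a<b$ are $0$. *)

(* Defs.v *)
From HB Require Import structures.
From mathcomp Require Import all_boot all_order all_algebra.
From mathcomp Require Import reals sequences exp.
From mathcomp Require Import ring.

Set Implicit Arguments.
Unset Strict Implicit.
Unset Printing Implicit Defensive.

Import Order.TTheory GRing.Theory Num.Theory.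

Local Open Scope ring_scope.

Definition ffact_poly (n : nat) : {poly int} :=
  \prod_(i < n) ('X - (i%:Z)%:P).

(* The defining identities of the Stirling numbers, as identities of
   polynomials in x = 'X.  They constrain only the values at 0 <= m <= n, which
   they determine uniquely; see the four lemmas ending this file. *)
Definition is_stirling1 (s : nat -> nat -> int) : Prop :=
  forall n : nat, \sum_(m < n.+1) s n m *: 'X^m = ffact_poly n.

Definition is_stirling2 (S : nat -> nat -> int) : Prop :=
  forall n : nat, \sum_(m < n.+1) S n m *: ffact_poly m = 'X^n.

Section Bounds.
Variables (R : realType) (n k : nat).

Definition bigN : nat := 'C(n, 2).

Definition mu : R := ('C(k, 2))%:R * ('C(n, 3))%:R / ('C(bigN, 2))%:R.

(* The subtractions below take place in R. *)
Definition overlap : R :=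
  (13 - 12 * k%:R + 3 * k%:R ^+ 2) / ('C(bigN, 2))%:R.

Definition d1 : R :=
  ('C(n, 3))%:R / ('C(bigN, 2))%:R + overlap +
  (1 - overlap) *
  (4 * (k%:R - 2) * ('C(n, 3))%:R / ('C(bigN, 2))%:R +
   6 * ('C(n, 4))%:R * (k%:R - 2) / (('C(n, 3))%:R * (bigN%:R - 2))).

Definition d2 : R :=
  2 * ('C(n, 3))%:R / ('C(bigN, 2))%:R + overlap +
  (1 - overlap) *
  (8 * (k%:R - 2) * ('C(n, 3))%:R / ('C(bigN, 2))%:R +
   6 * ('C(n, 4))%:R * (k%:R - 2) / (('C(n, 3))%:R * (bigN%:R - 2)) +
   (k%:R - 2) / (bigN%:R - 2) * ((5 * n%:R - 11) / 4)).

Definition D1 : R := Num.min d1 (Num.min (mu * d1) 1).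

Definition D2 : R := Num.min d2 (Num.min (2 * mu * d2) 1).

End Bounds.

Lemma ffact_polyS n : ffact_poly n.+1 = ffact_poly n * ('X - (n%:Z)%:P).
Proof. by rewrite /ffact_poly big_ord_recr. Qed.

Lemma size_ffact_poly n : size (ffact_poly n) = n.+1.
Proof. by rewrite /ffact_poly size_prod_XsubC /index_enum -enumT size_enum_ord. Qed.

Lemma monic_ffact_poly n : ffact_poly n \is monic.
Proof. exact: monic_prod_XsubC. Qed.

Lemma is_stirling1_exists : exists s, is_stirling1 s.
Proof.
exists (fun n m => (ffact_poly n)`_m) => n.
by rewrite -{2}[ffact_poly n]coefK size_ffact_poly poly_def.
Qed.

Lemma is_stirling1_unique s s' : is_stirling1 s -> is_stirling1 s' ->
  forall n m, (m <= n)%N -> s n m = s' n m.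
Proof.
move=> hs hs' n m le_mn.
have coefS t : is_stirling1 t -> t n m = (ffact_poly n)`_m.
  by move=> ht; rewrite -(ht n) -poly_def coef_poly ltnS le_mn.
by rewrite (coefS s) // (coefS s').
Qed.

Lemma is_stirling2_exists : exists S, is_stirling2 S.
Proof.
pose fix S (n m : nat) {struct n} : int :=
  match n, m with
  | 0, 0 => 1
  | 0, _.+1 => 0
  | n'.+1, 0 => 0
  | n'.+1, m'.+1 => (m'.+1)%:Z * S n' m'.+1 + S n' m'
  end.
have S_gt n : forall m, (n < m)%N -> S n m = 0.
  elim: n => [|n IHn] [|m] //= lt_nm.
  by rewrite !IHn ?mulr0 ?addr0 // ltnW.
exists S; elim=> [|n IHn].
  by rewrite big_ord1 /= /ffact_poly big_ord0 scale1r expr0.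
rewrite exprSr -IHn big_ord_recl /= scale0r add0r.
under eq_bigr => i _ do rewrite scalerDl.
rewrite big_split /=.
have -> : \sum_(i < n.+1)
    ((bump 0 i)%:Z * S n (bump 0 i)) *: ffact_poly (bump 0 i) =
    \sum_(i < n.+1) (i%:Z * S n i) *: ffact_poly i.
  rewrite [RHS]big_ord_recl mul0r scale0r add0r big_ord_recr /=.
  by rewrite [S n (bump 0 n)]S_gt // mulr0 scale0r addr0.
rewrite -big_split /= mulr_suml; apply: eq_bigr => i _.
rewrite /bump add1n ffact_polyS -!mul_polyC polyCM; ring.
Qed.

Lemma is_stirling2_unique S S' : is_stirling2 S -> is_stirling2 S' ->
  forall n m, (m <= n)%N -> S n m = S' n m.
Proof.
move=> hS hS' n.
have free j (a : nat -> int) : \sum_(i < j) a i *: ffact_poly i = 0 ->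
    forall m, (m < j)%N -> a m = 0.
  elim: j => [//|j IHj]; rewrite big_ord_recr /= => e.
  have aj : a j = 0.
    have := congr1 (fun p : {poly int} => p`_j) e.
    rewrite coefD coef_sum big1 => [|i _]; last first.
      by rewrite coefZ nth_default ?mulr0 // size_ffact_poly.
    have /monicP := monic_ffact_poly j.
    by rewrite lead_coefE size_ffact_poly coefZ /= => ->; rewrite coef0 add0r mulr1.
  move: e; rewrite aj scale0r addr0 => /IHj h m.
  by rewrite ltnS leq_eqVlt => /predU1P[-> //|/h].
move=> m le_mn; apply/eqP; rewrite -subr_eq0; apply/eqP.
apply: (free n.+1 (fun i => S n i - S' n i)) => //.
under eq_bigr => i _ do rewrite scalerBl.
by rewrite sumrB hS hS' subrr.
Qed.

(* Main.v *)
(* [|s(n, n-k)|] and [S(n, n-k)] count the placements of [k] rooks on a staircase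
   board of [N = 'C(n, 2)] cells with no two rooks in a column, respectively in a
   column or a row.  Let [q_k] be the fraction of [k]-subsets of cells that are
   such placements, and let [p] be the fraction of pairs of cells in conflict, so
   that the mean is [m_k = 'C(k, 2) p].  Double counting the ways to add a rook
   shows that [q_(j+1) / q_j] agrees with [y_j = exp(-j p)] up to a relative error
   in the deficit: [|q_(j+1) - y_j q_j| <= c (1 - y_j) q_j], where
   [c = (5 (k - 2) + 1) p].  As [m_(j+1) = m_j + j p], induction on [j] gives
   [|q_j - exp(-m_j)| <= c (1 - exp(-m_j))], and [1 - exp(-m) <= min(1, m)] while
   [c <= d] when [d < 1], for [d] either of [d1], [d2].  When [d >= 1] the union
   bound [q_k >= 1 - m_k] suffices.  For [n = k = 3] and the second kind, [d2]
   falls below [c] and the bound is checked directly. *)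

Require Import Defs.
From mathcomp Require Import all_boot all_order all_algebra.
From mathcomp Require Import reals sequences exp.
From mathcomp Require Import ring lra zify.

Import Order.TTheory GRing.Theory Num.Theory.
Local Open Scope ring_scope.

(** * Rook placements on the staircase *)

(* The number of placements of [k] rooks in the cells [(i, j)] with [i < j < n],
   no two in a column and, if [u = 1], no two in a row: the last column has [n']
   cells, of which the [k'] other rooks forbid [u * k']. *)
Fixpoint rook (u n k : nat) : nat :=
  match n, k with
  | 0, 0 => 1%N
  | 0, _.+1 => 0%N
  | _.+1, 0 => 1%N
  | n'.+1, k'.+1 => (rook u n' k'.+1 + (n' - u * k') * rook u n' k')%N
  end.

Arguments rook : simpl never.

Lemma rookn0 u n : rook u n 0 = 1%N.
Proof. by case: n. Qed.

Lemma rookSS u n k :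
  rook u n.+1 k.+1 = (rook u n k.+1 + (n - u * k) * rook u n k)%N.
Proof. by []. Qed.

Lemma rook_gt u n k : (n < k)%N -> rook u n k = 0%N.
Proof.
elim: n k => [|n IHn] [|k] // lt_nk.
by rewrite rookSS !IHn ?muln0 // ltnW.
Qed.

Lemma rook_ge u n k : (n < k)%N -> rook u n.+1 k = 0%N.
Proof.
elim: n k => [|n IHn] [|k] // lt_nk.
by rewrite rookSS !IHn ?muln0 // ltnW.
Qed.

(** * Double-counting inequalities between consecutive rook counts *)

Section RookInequalities.
Variables (R : realFieldType) (u : nat).
Hypothesis u_le1 : (u <= 1)%N.

(* The value [0] at negative indices makes the recurrence [rookzS] and the
   inequalities below valid at every index. *)
Definition rookz (n : nat) (k : int) : R :=
  if k is Posz k' then (rook u n k')%:R else 0.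

Local Notation f := rookz.
Local Notation a := (1 + u%:R : R).
Local Notation N := (fun n : nat => n%:R * (n%:R - 1) / 2 : R).
Local Notation T := (fun n : nat => a * n%:R * (n%:R - 1) * (n%:R - 2) / 3 : R).
Local Notation D := (fun n : nat => a * (n%:R - 1) : R).

Lemma intrB1 (k : int) : (k - 1)%:~R = k%:~R - 1 :> R.
Proof. by rewrite intrB. Qed.

Lemma rookz_ge0 n k : 0 <= f n k.
Proof. by case: k => k /=. Qed.

Lemma rookz_lt0 n (k : int) : k < 0 -> f n k = 0.
Proof. by case: k. Qed.

Lemma rookz_gt n (k : int) : n%:Z < k -> f n k = 0.
Proof. by case: k => //= k lt_nk; rewrite rook_gt. Qed.

Lemma rookz_ge n (k : int) : n%:Z < k -> f n.+1 k = 0.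
Proof. by case: k => //= k lt_nk; rewrite rook_ge. Qed.

Lemma rookzS n (k : int) :
  f n.+1 k = f n k + (n%:R - u%:R * (k%:~R - 1)) * f n (k - 1).
Proof.
case: k => [[|k]|k].
- have -> : 0%N%:Z - 1 = Negz 0 by [].
  by rewrite /= !rookn0 mulr0 addr0.
- have -> : k.+1%:Z - 1 = k by lia.
  have -> : (k.+1%:Z)%:~R - 1 = k%:R :> R by rewrite -pmulrn -natr1 addrK.
  rewrite /= rookSS natrD natrM; congr (_ + _).
  (* Truncated and true subtraction differ only for [k > n], where the factor [rook u n k]
     vanishes. *)
  have [le_kn|lt_nk] := leqP k n; last by rewrite rook_gt // !mulr0.
  rewrite natrB ?natrM //.
  by case: (u) u_le1 => [|[|]] // _; rewrite ?mul0n ?mul1n.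
- by rewrite !rookz_lt0 ?mulr0 ?addr0 //; lia.
Qed.

Lemma rookz0 k : f 0 k = (k == 0)%:R.
Proof. by case: k => [[|k]|k]. Qed.

Lemma mul_rookz_ge0 n (k : int) : 0 <= k%:~R * f n k.
Proof.
have [k_ge0|k_lt0] := leP 0 k; last by rewrite rookz_lt0 ?mulr0.
by rewrite mulr_ge0 ?rookz_ge0 // ler0z.
Qed.

Lemma u_cases : u%:R = 0 :> R \/ u%:R = 1 :> R.
Proof. by case: (u) u_le1 => [|[|]] // _; [left|right]. Qed.

Lemma coef_ge0 n (k : int) : k <= n%:Z -> 0 <= n%:R - u%:R * k%:~R :> R.
Proof.
move=> le_kn; rewrite subr_ge0.
have : k%:~R <= n%:R :> R by rewrite [n%:R]pmulrn ler_int.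
by case: u_cases => ->; rewrite ?mul0r ?mul1r.
Qed.

Lemma coef_rookz_ge0 n (k : int) : 0 <= (n%:R - u%:R * k%:~R) * f n k.
Proof.
have [le_kn|lt_nk] := leP k n; last by rewrite rookz_gt ?mulr0.
by rewrite mulr_ge0 ?rookz_ge0 ?coef_ge0.
Qed.

Lemma coef_pred_rookz_ge0 n (k : int) :
  0 <= (n%:R - 1) * ((n%:R - u%:R * k%:~R) * f n k).
Proof.
(* At [n = 0] the factor [n - 1] is negative, but [f 0 k] vanishes unless [k = 0], and there the
   middle factor is 0. *)
case: n => [|n]; last by rewrite -natr1 addrK mulr_ge0 // natr1 coef_rookz_ge0.
by rewrite rookz0; case: eqVneq => [->|_]; rewrite ?mulr0 ?subrr ?mul0r ?mulr0.
Qed.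

(* In the next four lemmas [N] is the number of cells, [T] the number of ordered
   pairs of conflicting cells, and [D] bounds the number of cells in conflict with
   or equal to a given one.  In each inductive step the difference at [n + 1] is
   the difference at [n], plus a nonnegative multiple of the difference at [n] and
   [k - 1], plus nonnegative terms. *)
Lemma rookz_upper n (k : int) :
  0 <= (N n - (k%:~R - 1)) * f n (k - 1) - k%:~R * f n k.
Proof.
elim: n k => [|n IHn] k.
  rewrite !rookz0 subr_eq0; case: (eqVneq k 0) => [->|_].
    by rewrite !mul0r mulr0 subr0.
  by case: (eqVneq k 1) => [->|_]; rewrite !mulr0 ?subrr //; lra.
have [le_kn|lt_nk] := leP (k - 1) n%:Z; last first.
  by rewrite !rookz_ge ?mulr0 ?subrr //; lia.
have h1 := IHn k.
have le_kn' : k - 1 - 1 <= n%:Z by lia.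
have h2 := mulr_ge0 (coef_ge0 n (k - 1 - 1) le_kn') (IHn (k - 1)).
have h3 := coef_pred_rookz_ge0 n (k - 1 - 1).
have h4 := mulr_ge0 (ler0n R (u * 2)) (mul_rookz_ge0 n (k - 1)).
rewrite !rookzS -natr1 !intrB1.
rewrite natrM !intrB1 in h1 h2 h3 h4.
set F1 := f n k in h1 h2 h3 h4 *; set F2 := f n (k - 1) in h1 h2 h3 h4 *.
set F3 := f n (k - 1 - 1) in h1 h2 h3 h4 *.
lra.
Qed.

(** Counting reason: each of the [k - 1] rooks already placed rules out at most [D n] cells for the
    next one. *)
Lemma rookz_lower n (k : int) :
  0 <= k%:~R * f n k - (N n - (k%:~R - 1) * D n) * f n (k - 1).
Proof.
elim: n k => [|n IHn] k.
  rewrite !rookz0 subr_eq0; case: (eqVneq k 0) => [->|_].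
    by rewrite !mul0r mulr0 subr0.
  case: (eqVneq k 1) => [->|_]; rewrite !mulr0 ?subrr //; lra.
have [le_kn|lt_nk] := leP (k - 1) n%:Z; last first.
  by rewrite !rookz_ge ?mulr0 ?subrr //; lia.
have h1 := IHn k.
have le_kn' : k - 1 - 1 <= n%:Z by lia.
have h2 := mulr_ge0 (coef_ge0 n (k - 1 - 1) le_kn') (IHn (k - 1)).
have h3 := mul_rookz_ge0 n (k - 1).
have h4 := coef_rookz_ge0 n (k - 1 - 1).
have h5 : 0 <= (k - 1 - 1)%:~R *
    ((n%:R - u%:R * (k - 1 - 1)%:~R) * f n (k - 1 - 1)).
  have [k_ge0|k_lt0] := leP 0 (k - 1 - 1).
    by rewrite mulr_ge0 ?ler0z ?coef_rookz_ge0.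
  by rewrite rookz_lt0 ?mulr0.
have h6 := mulr_ge0 (ler0n R n) h4.
rewrite !rookzS -natr1 !intrB1.
rewrite !intrB1 in h1 h2 h3 h4 h5 h6.
set F1 := f n k in h1 h2 h3 h4 *; set F2 := f n (k - 1) in h1 h2 h3 h4 *.
set F3 := f n (k - 1 - 1) in h1 h2 h3 h4 h5 h6 *.
case: u_cases => Eu; rewrite Eu in h1 h2 h3 h4 h5 h6 *; lra.
Qed.

Lemma conflicts_ge0 n : 0 <= T n.
Proof.
case: n => [|[|n]]; [by rewrite !mulr0 !mul0r|by rewrite subrr !mulr0 !mul0r|].
have n_ge0 : 0 <= n%:R :> R by [].
have u_ge0 : 0 <= u%:R :> R by [].
rewrite -addn2 natrD.
have -> : (1 + u%:R) * (n%:R + 2) * (n%:R + 2 - 1) * (n%:R + 2 - 2) / 3 =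
  (1 + u%:R) * (n%:R + 2) * (n%:R + 1) * n%:R / 3 :> R by field.
by rewrite divr_ge0 // !mulr_ge0 // ?addr_ge0.
Qed.

(** Counting reason: a free cell that cannot take the next rook conflicts with some placed rook.
    Such an ordered conflicting pair leaves a placement of the other [k - 2] rooks, so there are at
    most [T n * f n (k - 2)] failures. *)
Lemma rookz_edge_upper n (k : int) :
  0 <= k%:~R * f n k - (N n - (k%:~R - 1)) * f n (k - 1) + T n * f n (k - 2).
Proof.
elim: n k => [|n IHn] k.
  rewrite !rookz0 subr_eq0; case: (eqVneq k 0) => [->|_].
    by rewrite /= mulr0; lra.
  case: (eqVneq k 1) => [->|_]; rewrite !mulr0 ?mul0r ?subrr //; lra.
have [le_kn|lt_nk] := leP (k - 1) n%:Z; last first.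
  have -> : f n.+1 k = 0 by rewrite rookz_ge //; lia.
  have -> : f n.+1 (k - 1) = 0 by rewrite rookz_ge.
  by rewrite !mulr0 subrr add0r; exact: mulr_ge0 (conflicts_ge0 _) (rookz_ge0 _ _).
have E1 : k - 1 - 1 = k - 2 by lia.
have E2 : k - 1 - 2 = k - 3 by lia.
have E3 : k - 2 - 1 = k - 3 by lia.
have h1 := IHn k.
have h2 := mulr_ge0 (coef_ge0 n (k - 1) le_kn) (IHn (k - 1)).
have h3 := mul_rookz_ge0 n (k - 2).
have h4 := mulr_ge0 (ler0n R n) h3.
have h5 := mulr_ge0 (conflicts_ge0 n) (rookz_ge0 n (k - 3)).
have h6 := mulr_ge0 (ler0n R n) (coef_pred_rookz_ge0 n (k - 3)).
have h7 := rookz_upper n (k - 1).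
rewrite !rookzS -natr1 ?E1 ?E2 ?E3.
rewrite ?E1 ?E2 ?E3 in h1 h2 h3 h4 h5 h6 h7.
rewrite !intrB in h1 h2 h3 h4 h5 h6 h7 *.
set F1 := f n k in h1 h2 h3 h4 h5 h6 h7 *.
set F2 := f n (k - 1) in h1 h2 h3 h4 h5 h6 h7 *.
set F3 := f n (k - 2) in h1 h2 h3 h4 h5 h6 h7 *.
set F4 := f n (k - 3) in h1 h2 h3 h4 h5 h6 h7 *.
case: u_cases => Eu; rewrite Eu in h1 h2 h3 h4 h5 h6 h7 *; lra.
Qed.

Lemma natr_pred_ge0 n : 0 <= n%:R * (n%:R - 1) :> R.
Proof.
case: n => [|n]; first by rewrite mul0r.
by rewrite -natr1 addrK mulr_ge0 // addr_ge0.
Qed.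

Lemma conflicts_degree_ge0 n : 0 <= T n * D n.
Proof.
case: n => [|n]; first by rewrite !(mulr0, mul0r).
apply: mulr_ge0 (conflicts_ge0 _) _.
by rewrite -natr1 addrK mulr_ge0 // addr_ge0.
Qed.

Lemma conflicts_degree_mono n : 0 <= T n.+1 * D n.+1 - T n * D n.
Proof.
have n_ge0 : 0 <= n%:R :> R by [].
have h1 := mulr_ge0 (addr_ge0 ler01 (ler0n R u)) (conflicts_ge0 n).
have h2 := mulr_ge0 (sqr_ge0 (1 + u%:R : R)) (natr_pred_ge0 n).
rewrite -natr1; lra.
Qed.

(** Counting reason, as a second-order Bonferroni bound: for a given conflicting pair, at most
    [D n * f n (k - 3)] of the placements of [k - 2] rooks are incompatible with the rook of the
    pair. A cell hit twice is fixed by one rook in its row and one in its column, which gives the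
    term in [u]. *)
Lemma rookz_edge_lower n (k : int) :
  0 <= (N n - (k%:~R - 1) + u%:R * (k%:~R - 1) * (k%:~R - 2)) * f n (k - 1)
       - T n * f n (k - 2) + T n * D n * f n (k - 3) - k%:~R * f n k.
Proof.
elim: n k => [|n IHn] k.
  rewrite !rookz0 subr_eq0; case: (eqVneq k 0) => [->|_].
    by rewrite /= mulr0; lra.
  case: (eqVneq k 1) => [->|_]; rewrite /= ?mulr0 ?mul0r ?subrr //; lra.
have [le_kn|lt_nk] := leP (k - 1) n%:Z; last first.
  have -> : f n.+1 k = 0 by rewrite rookz_ge //; lia.
  have -> : f n.+1 (k - 1) = 0 by rewrite rookz_ge.
  have h := mulr_ge0 (conflicts_degree_ge0 n.+1) (rookz_ge0 n.+1 (k - 3)).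
  (* Past the range, a negative term survives only for [k = n + 2]. It is absorbed by the [D] term,
     because [rookz_upper] yields [f n.+1 n <= n * f n.+1 (n - 1)]. *)
  have [eq_kn|neq_kn] := eqVneq (k - 2) n; last first.
    have -> : f n.+1 (k - 2) = 0 by rewrite rookz_ge //; lia.
    lra.
  have := rookz_upper n.+1 n.
  have -> : k - 3 = n%:Z - 1 by lia.
  rewrite eq_kn -[n%:~R]/(n%:R).
  have := rookz_ge0 n.+1 (n%:Z - 1).
  have := rookz_ge0 n.+1 n.
  have := conflicts_ge0 n.+1.
  set F1 := f _ _; set F2 := f _ _.
  case: (posnP n) => [->|n_gt0] T_ge0 F1_ge0 F2_ge0 h1.
    by rewrite subrr !(mulr0, mul0r); lra.
  have n_ge1 : 1 <= n%:R :> R by rewrite ler1n.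
  have F12 : F1 <= n%:R * F2.
    have h2 : 0 <= (n%:R - 1) * (n%:R + 2) * F2.
      by rewrite !mulr_ge0 ?subr_ge0 ?addr_ge0.
    have : n%:R * F1 <= n%:R * (n%:R * F2) by move: h1; rewrite -natr1; lra.
    by rewrite ler_pM2l // ltr0n.
  have F12' : F1 <= D n.+1 * F2.
    have h2 : 0 <= n%:R * F2 by rewrite mulr_ge0.
    by rewrite -natr1; case: u_cases => ->; lra.
  have := ler_wpM2l T_ge0 F12'; lra.
have E1 : k - 1 - 1 = k - 2 by lia.
have E2 : k - 1 - 2 = k - 3 by lia.
have E3 : k - 2 - 1 = k - 3 by lia.
have E4 : k - 1 - 3 = k - 4 by lia.
have E5 : k - 3 - 1 = k - 4 by lia.
(* The factor [n + (k - 3)] may be negative for [k < 3], but then the bracket vanishes. *)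
have h9 : 0 <= (n%:R + (k - 3)%:~R) *
    ((N n - ((k - 2)%:~R - 1)) * f n (k - 3) - (k - 2)%:~R * f n (k - 2)).
  have [k_ge3|k_lt3] := leP 3 k.
    have := rookz_upper n (k - 2).
    have -> : k - 2 - 1 = k - 3 by lia.
    by apply: mulr_ge0; rewrite addr_ge0 // ler0z; lia.
  rewrite (rookz_lt0 n (k - 3)) ?mulr0 ?sub0r; last lia.
  have [->|k_neq2] := eqVneq k 2; first by rewrite subrr mul0r oppr0 mulr0.
  by rewrite (rookz_lt0 n (k - 2)) ?mulr0 ?oppr0 ?mulr0 //; lia.
have h10 : 0 <= (n%:R + (k - 3)%:~R) * ((k - 3)%:~R * f n (k - 3)).
  have [k_ge3|k_lt3] := leP 3 k.
    by rewrite mulr_ge0 ?mul_rookz_ge0 // addr_ge0 // ler0z; lia.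
  by rewrite (rookz_lt0 n (k - 3)) ?mulr0 //; lia.
have h1 := IHn k.
have h2 := mulr_ge0 (coef_ge0 n (k - 1) le_kn) (IHn (k - 1)).
have h3 := mulr_ge0 (conflicts_degree_mono n) (coef_rookz_ge0 n (k - 4)).
have h4 := mulr_ge0 (conflicts_degree_ge0 n) (rookz_ge0 n (k - 4)).
have h5 := mulr_ge0 (conflicts_ge0 n) (rookz_ge0 n (k - 3)).
have h6 := rookz_lower n (k - 1).
have h7 := mulr_ge0 (natr_pred_ge0 n) (mulr_ge0 (ler0n R n) (rookz_ge0 n (k - 3))).
have h8 := mulr_ge0 (natr_pred_ge0 n) (mul_rookz_ge0 n (k - 3)).
have En : n.+1%:R = n%:R + 1 :> R by rewrite natr1.
rewrite !rookzS En ?E1 ?E2 ?E3 ?E4 ?E5.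
rewrite ?En ?E1 ?E2 ?E3 ?E4 ?E5 in h1 h2 h3 h4 h5 h6 h7 h8 h9 h10.
rewrite !intrB in h1 h2 h3 h4 h5 h6 h7 h8 h9 h10 *.
set F1 := f n k in h1 h2 h3 h4 h5 h6 h7 h8 h9 h10 *.
set F2 := f n (k - 1) in h1 h2 h3 h4 h5 h6 h7 h8 h9 h10 *.
set F3 := f n (k - 2) in h1 h2 h3 h4 h5 h6 h7 h8 h9 h10 *.
set F4 := f n (k - 3) in h1 h2 h3 h4 h5 h6 h7 h8 h9 h10 *.
set F5 := f n (k - 4) in h1 h2 h3 h4 h5 h6 h7 h8 h9 h10 *.
case: u_cases => Eu; rewrite Eu in h1 h2 h3 h4 h5 h6 h7 h8 h9 h10 *.
  by clear -h1 h2 h3 h5; lra.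
(* For [u = 1] the difference at [n + 1] is exactly the sum [h] below, with weight 3 on [h4] and 3/2
   on [h7 + h8]. *)
have h4' := mulr_ge0 (ler0n R 3) h4.
have h78 := divr_ge0 (mulr_ge0 (ler0n R 3) (addr_ge0 h7 h8)) (ler0n R 2).
have h := addr_ge0 (addr_ge0 (addr_ge0 (addr_ge0 h1 h2) (addr_ge0 h3 h4'))
  (addr_ge0 h6 h9)) (addr_ge0 h10 h78).
apply: (le_trans h); rewrite le_eqVlt; apply/orP; left; apply/eqP.
by field.
Qed.
End RookInequalities.

(** * Stirling numbers as rook counts *)

Lemma rook_subS u n i : (i < n)%N ->
  rook u n.+1 (n - i) =
  (rook u n (n - i) + (n - u * (n - i.+1)) * rook u n (n - i.+1))%N.
Proof. by move=> lt_in; rewrite -(subnSK lt_in) rookSS. Qed.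

(** With [k = n - i], the last column offers [n - (n - i - 1) = i + 1] cells, so the rook recurrence
    becomes [S(n+1, i+1) = S(n, i) + (i+1) S(n, i+1)]. Uniqueness of the defining expansion then
    identifies the two. *)
Lemma stirling2_rook (S : nat -> nat -> int) : is_stirling2 S ->
  forall n k, (k <= n)%N -> S n (n - k)%N = (rook 1 n k)%:Z.
Proof.
move=> hS n k le_kn.
pose S' n m := (rook 1 n (n - m))%:Z.
suff hS' : is_stirling2 S'.
  by rewrite (is_stirling2_unique hS hS') ?leq_subr // /S' subKn.
elim=> [|{le_kn}{}n IHn].
  by rewrite big_ord1 /S' /ffact_poly big_ord0 scale1r expr0.
rewrite big_ord_recl {1}/S' subn0 rook_ge // scale0r add0r.
rewrite exprSr -IHn mulr_suml.
(* The guard matters at [i = n]: truncation makes [S' n n.+1] equal to 1 instead of 0. *)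
transitivity (\sum_(i < n.+1) (S' n i *: ffact_poly i.+1 +
    (if (i < n)%N then i.+1%:Z * S' n i.+1 else 0) *: ffact_poly i.+1)).
  apply: eq_bigr => i _; rewrite -scalerDl; congr (_ *: _).
  rewrite /S' lift0 subSS.
  have [lt_in|le_ni] := ltnP i n; last first.
    by rewrite (_ : (n - i = 0)%N) ?rookn0 ?addr0 //; apply/eqP.
  by rewrite rook_subS // mul1n subKn // PoszD PoszM.
rewrite big_split /=.
have -> : \sum_(i < n.+1) (if (i < n)%N then i.+1%:Z * S' n i.+1 else 0)
     *: ffact_poly i.+1 = \sum_(i < n.+1) (i%:Z * S' n i) *: ffact_poly i.
  rewrite [RHS]big_ord_recl mul0r scale0r add0r.
  rewrite big_ord_recr /= ltnn scale0r addr0.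
  by apply: eq_bigr => i _; rewrite ltn_ord.
rewrite -big_split /=; apply: eq_bigr => i _.
rewrite ffact_polyS -!mul_polyC polyCM; ring.
Qed.

(** With [u = 0] and the sign [(-1)^(n-m)], the rook recurrence is
    [s(n+1, i+1) = s(n, i) - n s(n, i+1)], which is multiplication by ['X - n]. *)
Lemma stirling1_rook (s : nat -> nat -> int) : is_stirling1 s ->
  forall n k, (k <= n)%N -> `|s n (n - k)%N| = (rook 0 n k)%:Z.
Proof.
move=> hs n k le_kn.
pose s' n m : int := (-1) ^+ (n - m) * (rook 0 n (n - m))%:Z.
suff hs' : is_stirling1 s'.
  rewrite (is_stirling1_unique hs hs') ?leq_subr // /s' subKn //.
  by rewrite normrM normrX normrN1 expr1n mul1r.
elim=> [|{le_kn}{}n IHn].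
  by rewrite big_ord1 /s' /ffact_poly big_ord0 /= mulr1 scale1r expr0.
rewrite big_ord_recl {1}/s' subn0 rook_ge // mulr0 scale0r add0r.
rewrite ffact_polyS -IHn mulr_suml.
transitivity (\sum_(i < n.+1) (s' n i *: 'X^(i.+1) -
    (if (i < n)%N then n%:Z * s' n i.+1 else 0) *: 'X^(i.+1)) : {poly int}).
  apply: eq_bigr => i _; rewrite -scalerBl; congr (_ *: _).
  rewrite /s' lift0 subSS.
  have [lt_in|le_ni] := ltnP i n; last first.
    by rewrite (_ : (n - i = 0)%N) ?rookn0 ?subr0 //; apply/eqP.
  rewrite rook_subS // mul0n subn0 PoszD PoszM.
  rewrite -[in (-1) ^+ (n - i)](subnSK lt_in) exprS; ring.
rewrite !sumrB.
have -> : \sum_(i < n.+1) (if (i < n)%N then n%:Z * s' n i.+1 else 0)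
     *: 'X^(i.+1) = \sum_(i < n.+1) (n%:Z * s' n i) *: 'X^i :> {poly int}.
  rewrite [RHS]big_ord_recl big_ord_recr /= ltnn scale0r addr0.
  have -> : n%:Z * s' n 0%N = 0.
    by case: (n) => [|m]; rewrite ?mul0r // /s' subn0 rook_ge // !mulr0.
  by rewrite scale0r add0r; apply: eq_bigr => i _; rewrite ltn_ord.
rewrite -sumrB; apply: eq_bigr => i _.
rewrite exprSr -!mul_polyC (polyCM n%:Z); ring.
Qed.

(** * The union bound for conflicting cells *)

Lemma bin_addn_le n N k :
  ('C(N + n, k.+1) <= 'C(N, k.+1) + n * 'C(N + n.-1, k))%N.
Proof.
elim: n => [|n IHn]; first by rewrite addn0 mul0n addn0.
rewrite addnS binS /= mulSn.
have : (n * 'C(N + n.-1, k) <= n * 'C(N + n, k))%N.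
  by rewrite leq_mul2l leq_bin2l ?orbT // leq_add2l leq_pred.
lia.
Qed.

(** A subset meets the [n] new elements in none, in exactly one, or contains one of the ['C(n, 2)]
    new pairs. *)
Lemma bin_addn2_le n N k :
  ('C(N + n, k.+2) <=
   'C(N, k.+2) + n * 'C(N, k.+1) + 'C(n, 2) * 'C(N + n - 2, k))%N.
Proof.
elim: n => [|n IHn]; first by rewrite addn0 mul0n !addn0.
rewrite addnS binS.
have h1 := bin_addn_le n N k.
have h2 : (n * 'C(N + n.-1, k) <= n * 'C((N + n).+1 - 2, k))%N.
  by case: (n) => // m; rewrite leq_mul2l leq_bin2l ?orbT //; lia.
have h3 : ('C(n, 2) * 'C(N + n - 2, k) <= 'C(n, 2) * 'C((N + n).+1 - 2, k))%N.
  by rewrite leq_mul2l leq_bin2l ?orbT //; lia.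
rewrite [in X in (_ <= X)%N]binS bin1 mulnDl mulSn.
lia.
Qed.

Lemma bin_addn_ge n N k : ('C(N, k.+1) + n * 'C(N, k) <= 'C(N + n, k.+1))%N.
Proof.
elim: n => [|n IHn]; first by rewrite addn0 mul0n addn0.
rewrite addnS binS mulSn.
have : ('C(N, k) <= 'C(N + n, k))%N by rewrite leq_bin2l // leq_addr.
lia.
Qed.

Lemma rookn1 u n : rook u n 1 = 'C(n, 2).
Proof.
by elim: n => // n IHn; rewrite rookSS IHn muln0 subn0 rookn0 muln1 binS bin1.
Qed.

Lemma rook_le_bin u n k : (rook u n k <= 'C('C(n, 2), k))%N.
Proof.
elim: n k => [|n IHn] [|k] //; first by rewrite rookn0 bin0.
rewrite rookSS binS bin1; apply: leq_trans (bin_addn_ge n _ k).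
by rewrite leq_add ?leq_mul ?leq_subr.
Qed.

(** Union bound: a subset that is not a placement contains one of the [(1 + u) * 'C(n, 3)]
    conflicting pairs. The induction adds a column of [n] cells, which creates [(1 + u) * 'C(n, 2)]
    new pairs. *)
Lemma bin_le_rook u n k : (u <= 1)%N ->
  ('C('C(n, 2), k.+2) <=
   rook u n k.+2 + (1 + u) * 'C(n, 3) * 'C('C(n, 2) - 2, k))%N.
Proof.
move=> u_le1; elim: n k => [|n IHn] k //.
rewrite rookSS !(binS n) bin1.
set N := 'C(n, 2); set M := 'C(n, 3).
apply: leq_trans (bin_addn2_le n N k) _; rewrite -/N.
(* Old pairs, completed by a set with none or one of its cells in the new column. The match supplies
   0 for [k = 0], where truncation would give 1. *)
have hM : (M * 'C(N - 2, k) +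
    n * (if k is k'.+1 then M * 'C(N - 2, k') else 0) <=
    M * 'C(N + n - 2, k))%N.
  case: k => [|k]; first by rewrite !bin0 muln0 addn0.
  have [n_ge3|n_lt3] := leqP 3 n; last by rewrite /M bin_small // !mul0n !muln0.
  have N_ge2 : (2 <= N)%N.
    by apply: leq_trans (leq_bin2l 2 n_ge3).
  rewrite mulnCA -mulnDr leq_mul2l -addnBAC //.
  by rewrite bin_addn_ge orbT.
have h1 : ('C(N, k.+1) <=
    rook u n k.+1 + (1 + u) * (if k is k'.+1 then M * 'C(N - 2, k') else 0))%N.
  case: k {hM} => [|k]; first by rewrite bin1 rookn1 leq_addr.
  by rewrite mulnA IHn.
(* Row conflicts with the new column: each of the [N] old cells shares its row with exactly one new
   cell. *)
have h2 : (n * rook u n k.+1 <=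
    (n - u * k.+1) * rook u n k.+1 + u * (N * 'C(N + n - 2, k)))%N.
  have h : (k.+1 * rook u n k.+1 <= N * 'C(N + n - 2, k))%N.
    apply: (@leq_trans (k.+1 * 'C(N, k.+1))).
      by rewrite leq_mul2l rook_le_bin orbT.
    rewrite -mul_bin_diag leq_mul2l /N.
    by case: (n) => [|[|m]] //; rewrite leq_bin2l ?orbT //; lia.
  apply: (@leq_trans ((n - u * k.+1 + u * k.+1) * rook u n k.+1)).
    by rewrite leq_mul2r; lia.
  by rewrite mulnDl leq_add2l -mulnA leq_mul2l h orbT.
have h3 := IHn k.
have : (n * 'C(N, k.+1) <= n * (rook u n k.+1 +
   (1 + u) * (if k is k'.+1 then M * 'C(N - 2, k') else 0)))%N.
  by rewrite leq_mul2l h1 orbT.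
move: hM h2 h3; rewrite -/N -/M; set X := (if k is _.+1 then _ else _).
case: u u_le1 {IHn h1} => [|[|]] // _; nia.
Qed.

(** * The step ratio *)

(* With [a = 1 + u] the conflict density is [p = 4 a / (3 (n + 1))]; the next three
   lemmas have the denominators of [p] cleared, and their smallness hypothesis
   says [(5 l + 1) p < 1]. *)
Lemma small_gap (R : realFieldType) (a n l : R) : 1 <= a -> 3 <= n ->
  20 * a * l + 4 * a < 3 * (n + 1) ->
  0 < n - 2 * a * l.
Proof. by move=> *; lra. Qed.

Lemma ratio_upper (R : realFieldType) (a n l : R) : 1 <= a -> 3 <= n ->
  l = 0 \/ 1 <= l -> 20 * a * l + 4 * a < 3 * (n + 1) ->
  n * (n * (n - 1) / 2 - 1) * (3 * (n + 1) + 4 * a * l + 4 * a) <=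
  (3 * (n + 1) + 20 * a * l + 4 * a) * (n * (n - 1) / 2 - 1 - l) *
  (n - 2 * a * l).
Proof.
move=> a_ge1 n_ge3 l_case sm; have gap := small_gap _ _ _ _ a_ge1 n_ge3 sm.
case: l_case sm gap => [->|l_ge1] sm gap; first lra.
have al_ge0 : 0 <= a * l by rewrite mulr_ge0; lra.
have al_gea : a <= a * l by rewrite ler_peMr; lra.
have n_ge7 : 7 <= n by lra.
(* The right side minus the left is the sum of the quantities in [h1] and [h4]. The first is
   nonnegative by smallness, the second by [h2] and [h3]. *)
have h1 : 0 <= 2 * (a * l) * (3 * (n + 1) - 20 * a * l - 4 * a) *
    (n * (n - 1) / 2 - 1).
  by apply: mulr_ge0; [apply: mulr_ge0; lra | nra].
have h2 : (3 * (n + 1) + 20 * a * l + 4 * a) * (n - 2 * a * l) <=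
    6 * (n + 1) * (n - 2).
  apply: ler_pM; lra.
have h3 : 6 * (n + 1) * (n - 2) <= 4 * a * (n - 3) * (n * (n - 1) / 2 - 1).
  have h : 6 * (n + 1) * (n - 2) <= 4 * (n - 3) * (n * (n - 1) / 2 - 1).
    have -> : n * (n - 1) / 2 - 1 = (n - 2) * (n + 1) / 2 by field.
    have : 0 <= (n + 1) * (n - 2) * (n - 6) by rewrite !mulr_ge0 //; lra.
    lra.
  have : 0 <= (a - 1) * ((n - 3) * (n * (n - 1) / 2 - 1)).
    by apply: mulr_ge0; [lra | apply: mulr_ge0; nra].
  lra.
have h4 : 0 <= l * (4 * a * (n - 3) * (n * (n - 1) / 2 - 1) -
   (3 * (n + 1) + 20 * a * l + 4 * a) * (n - 2 * a * l)).
  by apply: mulr_ge0; lra.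
lra.
Qed.

Lemma ratio_lower (R : realFieldType) (a n l : R) : 1 <= a -> 3 <= n ->
  l = 0 \/ 1 <= l -> 20 * a * l + 4 * a < 3 * (n + 1) ->
  3 / 4 * ((n + 1) * l * (n - 2 * a * l + 2 * a)) <=
  (n - 2) / 3 * (4 * a * (5 * l + 1) * (n - 2 * a * l + 2 * a)
    - 6 * a * l * (n + 1)).
Proof.
move=> a_ge1 n_ge3 [->|l_ge1] sm.
  by rewrite !(mulr0, mul0r, subr0, add0r) mulr1 !mulr_ge0 //; lra.
have al_ge0 : 0 <= a * l by rewrite mulr_ge0; lra.
set w := n - 2 * a * l + 2 * a.
have hw : 7 / 10 * (n + 1) <= w by rewrite /w; lra.
have h1 : 0 <= (n - 2) / 3 * (6 * (a * l) * (10 / 7 * w - (n + 1)) + 4 * a * w).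
  by apply: mulr_ge0; [lra | apply: addr_ge0; rewrite !mulr_ge0 //; lra].
have h2 : 0 <= (l * (a - 1)) * (n - 2) * w by rewrite !mulr_ge0 //; lra.
have h3 : 0 <= (l * w) * (80 / 21 * (n - 2) - 3 / 4 * (n + 1)).
  by rewrite !mulr_ge0 //; lra.
lra.
Qed.

(* [F], [F0], [F1] stand for the numbers of placements of [l - 1], [l], [l + 1]
   rooks, [J] for [l + 2] times that of [l + 2] rooks, and [y] for
   [exp(-(l + 1) p)]. *)
Lemma rook_step_upper (R : realFieldType) (a n l p y F0 F1 J : R) :
  1 <= a -> 3 <= n -> l = 0 \/ 1 <= l -> p = 4 * a / (3 * (n + 1)) ->
  (5 * l + 1) * p < 1 ->
  (l + 1) * p <= (1 + (l + 1) * p) * (1 - y) ->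
  0 <= F1 ->
  0 <= J - (n * (n - 1) / 2 - l - 1) * F1
    + a * n * (n - 1) * (n - 2) / 3 * F0 ->
  0 <= (l + 1) * F1 - (n * (n - 1) / 2 - l * (a * (n - 1))) * F0 ->
  (n * (n - 1) / 2 - l - 1) * F1 - J <=
  (1 + (5 * l + 1) * p) * ((1 - y) * ((n * (n - 1) / 2 - l - 1) * F1)).
Proof.
move=> a_ge1 n_ge3 l_case pE small y_le F1_ge0 hC hB.
have l_ge0 : 0 <= l by case: l_case => [->|]; lra.
have s_gt0 : 0 < 3 * (n + 1) by lra.
have small' : 20 * a * l + 4 * a < 3 * (n + 1).
  by move: small; rewrite pE mulrA ltr_pdivrMr //; lra.
have gap := small_gap _ _ _ _ a_ge1 n_ge3 small'.
have ratio := ratio_upper _ _ _ _ a_ge1 n_ge3 l_case small'.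
set N := n * (n - 1) / 2 in hC hB ratio *.
set K := N - l - 1 in hC *.
set Q := N - l * (a * (n - 1)) in hB.
set T := a * n * (n - 1) * (n - 2) / 3 in hC.
have QE : Q = (n - 1) / 2 * (n - 2 * a * l) by rewrite /Q /N; field.
have Q_gt0 : 0 < Q by rewrite QE mulr_gt0 //; lra.
have T_ge0 : 0 <= T by rewrite divr_ge0 // !mulr_ge0 //; lra.
have TE : T = p * (N * (N - 1)) by rewrite pE /T /N; field; lra.
have K_gt0 : 0 < K.
  have : 0 < K * (n - 2 * a * l) * (3 * (n + 1) + 20 * a * l + 4 * a).
    apply: lt_le_trans
      (_ : n * (N - 1) * (3 * (n + 1) + 4 * a * l + 4 * a) <= _).
      have al_ge0 : 0 <= a * l by rewrite mulr_ge0; lra.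
      rewrite !mulr_gt0 //; first lra.
        by rewrite /N; nra.
      by lra.
    by apply: le_trans ratio _; rewrite /K; lra.
  have c_gt0 : 0 < 3 * (n + 1) + 20 * a * l + 4 * a.
    have al_ge0 : 0 <= a * l by rewrite mulr_ge0; lra.
    by lra.
  by rewrite pmulr_lgt0 // pmulr_lgt0.
have p_ge0 : 0 <= p by rewrite pE divr_ge0 //; lra.
have lp_ge0 : 0 <= l * p by rewrite mulr_ge0.
set t := (l + 1) * p in y_le.
have t_ge0 : 0 <= t by rewrite /t; lra.
(* The extra factor [1 + t] pays for replacing [t] by [1 - y] through [y_le]. *)
have ratio' : N * (N - 1) * (1 + t) <= (1 + (5 * l + 1) * p) * K * Q.
  have -> : N * (N - 1) * (1 + t) = (n - 1) / (2 * (3 * (n + 1))) *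
      (n * (N - 1) * (3 * (n + 1) + 4 * a * l + 4 * a)).
    by rewrite /t pE /N; field; lra.
  have -> : (1 + (5 * l + 1) * p) * K * Q = (n - 1) / (2 * (3 * (n + 1))) *
     ((3 * (n + 1) + 20 * a * l + 4 * a) * (N - 1 - l) * (n - 2 * a * l)).
    by rewrite QE /K pE /N; field; lra.
  by rewrite ler_wpM2l // divr_ge0 //; lra.
rewrite -(ler_pM2r Q_gt0).
have h1 : (K * F1 - J) * Q <= T * (l + 1) * F1.
  apply: (@le_trans _ _ (T * F0 * Q)); first by rewrite ler_pM2r //; lra.
  have := mulr_ge0 T_ge0 hB; lra.
apply: le_trans h1 _.
have -> : T * (l + 1) * F1 = t * (N * (N - 1)) * F1 by rewrite TE /t; ring.
have -> : (1 + (5 * l + 1) * p) * ((1 - y) * (K * F1)) * Q =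
  (1 - y) * ((1 + (5 * l + 1) * p) * K * Q) * F1 by ring.
rewrite ler_wpM2r //.
have h2 := ler_wpM2l t_ge0 ratio'.
have X_ge0 : 0 <= (1 + (5 * l + 1) * p) * K * Q.
  by rewrite !mulr_ge0 //; lra.
have h3 := ler_wpM2r X_ge0 y_le.
have t1_gt0 : 0 < 1 + t by lra.
rewrite -(ler_pM2r t1_gt0).
lra.
Qed.

Lemma rook_step_lower (R : realFieldType) (a n l p y F F0 F1 J : R) :
  1 <= a -> 3 <= n -> l = 0 \/ 1 <= l -> p = 4 * a / (3 * (n + 1)) ->
  (5 * l + 1) * p < 1 -> a - 1 <= a / 2 ->
  1 - y <= (l + 1) * p ->
  0 <= y -> y <= 1 -> 0 <= F0 ->
  0 <= F1 -> 0 <= n * (n - 1) / 2 - l - 1 ->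
  0 <= (n * (n - 1) / 2 - l - 1 + (a - 1) * (l + 1) * l) * F1
    - a * n * (n - 1) * (n - 2) / 3 * F0
    + a * n * (n - 1) * (n - 2) / 3 * (a * (n - 1)) * F - J ->
  0 <= l * F0 - (n * (n - 1) / 2 - (l - 1) * (a * (n - 1))) * F ->
  0 <= (n * (n - 1) / 2 - l) * F0 - (l + 1) * F1 ->
  (1 - (5 * l + 1) * p) * ((1 - y) * ((n * (n - 1) / 2 - l - 1) * F1)) <=
  (n * (n - 1) / 2 - l - 1) * F1 - J.
Proof.
move=> a_ge1 n_ge3 l_case pE small a_le2 y_ge y_ge0 y_le1 F0_ge0 F1_ge0 K_ge0.
move=> hD hB hA.
have l_ge0 : 0 <= l by case: l_case => [->|]; lra.
have s_gt0 : 0 < 3 * (n + 1) by lra.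
have small' : 20 * a * l + 4 * a < 3 * (n + 1).
  by move: small; rewrite pE mulrA ltr_pdivrMr //; lra.
have gap := small_gap _ _ _ _ a_ge1 n_ge3 small'.
have ratio := ratio_lower _ _ _ _ a_ge1 n_ge3 l_case small'.
set N := n * (n - 1) / 2 in hD hB hA K_ge0 *.
set K := N - l - 1 in hD K_ge0 *.
set Q := N - (l - 1) * (a * (n - 1)) in hB.
set T := a * n * (n - 1) * (n - 2) / 3 in hD.
set w := n - 2 * a * l + 2 * a in ratio.
have w_gt0 : 0 < w by rewrite /w; lra.
have QE : Q = (n - 1) / 2 * w by rewrite /Q /N /w; field.
have Q_gt0 : 0 < Q by rewrite QE mulr_gt0 //; lra.
have N_gt0 : 0 < N by rewrite divr_gt0 // mulr_gt0; lra.
have T_ge0 : 0 <= T by rewrite divr_ge0 // !mulr_ge0 //; lra.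
have TE : T = p * (N * (N - 1)) by rewrite pE /T /N; field; lra.
have p_ge0 : 0 <= p by rewrite pE divr_ge0 //; lra.
set c := (5 * l + 1) * p in small *.
(* Both second-order losses, from cells hit twice and from incompatible placements, fit into the
   share [c] of the main term [T * Q]. *)
have key : (a - 1) * l * N * Q <= T * (c * Q - a * (n - 1) * l).
  have -> : T * (c * Q - a * (n - 1) * l) =
     a * n * (n - 1) ^+ 2 / (6 * (n + 1)) *
     ((n - 2) / 3 * (4 * a * (5 * l + 1) * w - 6 * a * l * (n + 1))).
    by rewrite /c QE pE /T; field; lra.
  apply: (@le_trans _ _ (a * n * (n - 1) ^+ 2 / (6 * (n + 1)) *
     (3 / 4 * ((n + 1) * l * w)))); last first.
    by rewrite ler_wpM2l // divr_ge0 ?mulr_ge0 ?sqr_ge0 //; lra.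
  have -> : a * n * (n - 1) ^+ 2 / (6 * (n + 1)) * (3 / 4 * ((n + 1) * l * w)) =
     a / 2 * (l * N * Q) by rewrite QE /N; field; lra.
  have -> : (a - 1) * l * N * Q = (a - 1) * (l * N * Q) by ring.
  rewrite ler_wpM2r //.
  by apply: mulr_ge0 (ltW _) => //; apply: mulr_ge0 (ltW _).
have QD_ge0 : 0 <= Q - a * (n - 1) * l.
  have : 0 <= T * (c * Q - a * (n - 1) * l).
    apply: le_trans key.
    apply: mulr_ge0 (ltW _) => //; apply: mulr_ge0 (ltW _) => //.
    by apply: mulr_ge0; lra.
  have T_gt0 : 0 < T by rewrite divr_gt0 // !mulr_gt0 //; lra.
  rewrite pmulr_rge0 // => h.
  have : 0 <= (1 - c) * Q by rewrite mulr_ge0 ?ltW // subr_gt0.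
  lra.
have h1 : (l + 1) * F1 <= N * F0.
  have : 0 <= l * F0 by rewrite mulr_ge0.
  lra.
have h2 : T * (Q - a * (n - 1) * l) * F0 - (a - 1) * (l + 1) * l * F1 * Q <=
    Q * (K * F1 - J).
  have TD_ge0 : 0 <= T * (a * (n - 1)).
    by apply: mulr_ge0 T_ge0 _; clear -a_ge1 n_ge3; apply: mulr_ge0; lra.
  have := mulr_ge0 TD_ge0 hB.
  have := mulr_ge0 (ltW Q_gt0) hD.
  lra.
have h3 : (l + 1) * F1 * (T * (1 - c) * Q) <= N * Q * (K * F1 - J).
  have g1 := ler_wpM2l (mulr_ge0 T_ge0 QD_ge0) h1.
  have g2 := ler_wpM2l (ltW N_gt0) h2.
  have lF_ge0 : 0 <= (l + 1) * F1 by rewrite mulr_ge0 ?addr_ge0.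
  have g3 := ler_wpM2l lF_ge0 key.
  lra.
have h4 : (l + 1) * p * (N - 1) * (1 - c) * F1 <= K * F1 - J.
  rewrite -(ler_pM2l (mulr_gt0 N_gt0 Q_gt0)); apply: le_trans h3.
  rewrite TE; lra.
apply: le_trans h4.
have c1_ge0 : 0 <= 1 - c by rewrite subr_ge0 ltW.
have -> : (l + 1) * p * (N - 1) * (1 - c) * F1 =
  (1 - c) * (((l + 1) * p) * ((N - 1) * F1)) by ring.
apply: ler_wpM2l => //; apply: ler_pM => //; first by rewrite subr_ge0.
  exact: mulr_ge0.
by apply: ler_wpM2r => //; rewrite /K; lra.
Qed.

(** * Poisson approximation *)

Lemma natr_bin2 (R : realFieldType) n :
  'C(n, 2)%:R = n%:R * (n%:R - 1) / 2 :> R.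
Proof.
elim: n => [|n IHn]; first by rewrite !mul0r.
by rewrite binS natrD bin1 IHn -natr1; field.
Qed.

Lemma natr_bin3 (R : realFieldType) n :
  'C(n, 3)%:R = n%:R * (n%:R - 1) * (n%:R - 2) / 6 :> R.
Proof.
elim: n => [|n IHn]; first by rewrite !mul0r.
have En : n.+1%:R = n%:R + 1 :> R by rewrite natr1.
by rewrite binS natrD natr_bin2 IHn En; field.
Qed.

Lemma natr_bin4 (R : realFieldType) n :
  'C(n, 4)%:R = n%:R * (n%:R - 1) * (n%:R - 2) * (n%:R - 3) / 24 :> R.
Proof.
elim: n => [|n IHn]; first by rewrite !mul0r.
have En : n.+1%:R = n%:R + 1 :> R by rewrite natr1.
by rewrite binS natrD natr_bin3 IHn En; field.
Qed.

Lemma leq_bin2 n : (3 <= n)%N -> (n <= 'C(n, 2))%N.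
Proof.
elim: n => // n IHn; rewrite leq_eqVlt => /predU1P[<- //|lt_3n].
by have := IHn lt_3n; rewrite binS bin1; lia.
Qed.

Lemma expRN_le (R : realType) (t : R) : 0 <= t ->
  t <= (1 + t) * (1 - expR (- t)).
Proof.
move=> t_ge0; rewrite expRN.
have h := expR_ge1Dx t.
have e_gt0 := expR_gt0 t.
have : (1 + t) * (expR t)^-1 <= 1 by rewrite ler_pdivrMr // mul1r.
lra.
Qed.

Section Approximation.
Variables (R : realType) (u n : nat).
Hypotheses (u_le1 : (u <= 1)%N) (n_ge3 : (3 <= n)%N).

Local Notation N := 'C(n, 2).
Local Notation q := (fun j : nat => (rook u n j)%:R / 'C(N, j)%:R : R).
Local Notation p := (4 * (1 + u%:R) / (3 * (n%:R + 1)) : R).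

(** Since [(l + 2) 'C(N, l + 2) = (N - l - 1) 'C(N, l + 1)], dividing the two deficit estimates by
    this number turns rook counts into fractions. *)
Lemma rook_prob_step l : (l.+2 <= n)%N -> (5 * l%:R + 1) * p < 1 ->
  `|q l.+2 - expR (- (l.+1%:R * p)) * q l.+1| <=
  (5 * l%:R + 1) * p * ((1 - expR (- (l.+1%:R * p))) * q l.+1).
Proof.
move=> lt_ln small.
have nR_ge3 : 3 <= n%:R :> R by rewrite ler_nat.
have a_ge1 : 1 <= 1 + u%:R :> R by rewrite lerDl.
have u_half : 1 + u%:R - 1 <= (1 + u%:R) / 2 :> R.
  by case: (u_cases R u u_le1) => ->; lra.
have l_case : l%:R = 0 :> R \/ 1 <= l%:R :> R.
  by case: (l) => [|m]; [left | right; rewrite ler1n].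
have lt_lN : (l.+1 < N)%N by apply: leq_trans lt_ln (leq_bin2 _ n_ge3).
have E1 : l.+2%:Z - 1 = l.+1 by lia.
have E2 : l.+2%:Z - 2 = l by lia.
have E3 : l.+2%:Z - 3 = l%:Z - 1 by lia.
have E4 : l.+1%:Z - 1 = l by lia.
have hC := rookz_edge_upper R u u_le1 n l.+2%:Z.
have hD := rookz_edge_lower R u u_le1 n l.+2%:Z.
have hB1 := rookz_lower R u u_le1 n l.+1%:Z.
have hB0 := rookz_lower R u u_le1 n l%:Z.
have hA := rookz_upper R u u_le1 n l.+1%:Z.
rewrite ?E1 ?E2 ?E3 ?E4 in hC hD hB1 hB0 hA.
rewrite /rookz -/(rookz R u n (l%:Z - 1)) in hC hD hB1 hB0 hA.
have El2 : (l.+2%:Z)%:~R = l%:R + 2 :> R.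
  by rewrite -[LHS]/(l.+2%:R) -addn2 natrD.
have El1 : (l.+1%:Z)%:~R = l%:R + 1 :> R by rewrite -[LHS]/(l.+1%:R) natr1.
have El0 : (l%:Z)%:~R = l%:R :> R by [].
have El1' : l.+1%:R = l%:R + 1 :> R by rewrite natr1.
rewrite ?El2 ?El1 ?El0 in hC hD hB1 hB0 hA; rewrite El1'.
set F2 := (rook u n l.+2)%:R in hC hD *.
have F1_ge0 : 0 <= (rook u n l.+1)%:R :> R by [].
have F0_ge0 : 0 <= (rook u n l)%:R :> R by [].
set F1 := (rook u n l.+1)%:R in hC hD hB1 hA F1_ge0 *.
set F0 := (rook u n l)%:R in hC hD hB1 hB0 hA F0_ge0.
set F := rookz _ _ _ _ in hD hB0.
set b1 := 'C(N, l.+1)%:R; set b2 := 'C(N, l.+2)%:R.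
have b1_gt0 : 0 < b1 :> R by rewrite ltr0n bin_gt0 ltnW.
have b2_gt0 : 0 < b2 :> R by rewrite ltr0n bin_gt0.
have b12 : (l%:R + 2) * b2 = (N%:R - l%:R - 1) * b1.
  have -> : N%:R - l%:R - 1 = (N - l.+1)%:R :> R.
    by rewrite natrB; [rewrite El1'; ring | exact: ltnW].
  have -> : l%:R + 2 = l.+2%:R :> R by rewrite -[l.+2]addn2 natrD.
  by rewrite -!natrM mul_bin_left.
have K_gt0 : 0 < N%:R - l%:R - 1 :> R.
  by have := lt_lN; rewrite -(ltr_nat R) El1'; lra.
rewrite natr_bin2 in b12 K_gt0.
have p_ge0 : 0 <= p by rewrite divr_ge0 // mulr_ge0 // addr_ge0.
have t_ge0 : 0 <= (l%:R + 1) * p by rewrite mulr_ge0 // addr_ge0.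
have y_le := expRN_le _ _ t_ge0.
have y_ge := expR_ge1Dx (- ((l%:R + 1) * p)).
have y_ge0 := expR_ge0 (- ((l%:R + 1) * p)).
have y_le1 : expR (- ((l%:R + 1) * p)) <= 1.
  by rewrite -[X in _ <= X]expR0 ler_expR oppr_le0.
set y := expR _ in y_le y_ge y_ge0 y_le1 *.
have up := rook_step_upper _ _ _ _ _ y F0 F1 ((l%:R + 2) * F2)
  a_ge1 nR_ge3 l_case erefl small y_le F1_ge0.
have low := rook_step_lower _ _ _ _ _ y F F0 F1 ((l%:R + 2) * F2)
  a_ge1 nR_ge3 l_case erefl small.
have {}up := up ltac:(clear -hC; lra) ltac:(clear -hB1; lra).
have {}low := low u_half ltac:(clear -y_ge; lra) y_ge0 y_le1 F0_ge0 F1_ge0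
  (ltW K_gt0) ltac:(clear -hD; lra) ltac:(clear -hB0; lra) ltac:(clear -hA; lra).
set K := n%:R * (n%:R - 1) / 2 - l%:R - 1 in b12 K_gt0 up low.
set kap := (5 * l%:R + 1) * p in up low *.
have Z_gt0 : 0 < (l%:R + 2) * b2 by rewrite mulr_gt0 // ltr_wpDl.
have -> : F2 / b2 = ((l%:R + 2) * F2) / ((l%:R + 2) * b2).
  by rewrite -mulf_div divff ?mul1r // gt_eqF // ltr_wpDl.
have -> : F1 / b1 = (K * F1) / ((l%:R + 2) * b2).
  by rewrite b12 -mulf_div divff ?mul1r // gt_eqF.
set Z := (l%:R + 2) * b2 in Z_gt0 *.
rewrite !mulrA -mulrBl normrM [`|Z^-1|]gtr0_norm ?invr_gt0 //.
rewrite ler_pM2r ?invr_gt0 // ler_norml.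
by apply/andP; split; lra.
Qed.

Lemma rook_prob_ge0 j : 0 <= q j.
Proof. by rewrite divr_ge0. Qed.

Lemma rook_prob_le1 j : (j <= n)%N -> q j <= 1.
Proof.
move=> le_jn.
have b_gt0 : 0 < 'C(N, j)%:R :> R.
  by rewrite ltr0n bin_gt0 (leq_trans le_jn) ?leq_bin2.
by rewrite ler_pdivrMr // mul1r ler_nat rook_le_bin.
Qed.

Lemma rook_prob_approx k j : (j.+1 <= k.+2)%N -> (k.+2 <= n)%N ->
  (5 * k%:R + 1) * p < 1 ->
  `|q j.+1 - expR (- ('C(j.+1, 2)%:R * p))| <=
  (5 * k%:R + 1) * p * (1 - expR (- ('C(j.+1, 2)%:R * p))).
Proof.
move=> le_jk le_kn small.
have p_ge0 : 0 <= p by rewrite divr_ge0 // mulr_ge0 // addr_ge0.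
set c := (5 * k%:R + 1) * p in small *.
have c_ge0 : 0 <= c by rewrite mulr_ge0 // addr_ge0 // mulr_ge0.
elim: j le_jk => [|j IHj] le_jk.
  rewrite [in 'C(1, 2)]bin_small // mulr0n mul0r oppr0 expR0 rookn1 bin1.
  rewrite divff ?subrr ?normr0 ?mulr0 //.
  by rewrite pnatr_eq0 -lt0n bin_gt0 (leq_trans _ n_ge3).
have {}IHj := IHj (ltnW le_jk).
rewrite binS bin1 natrD mulrDl opprD expRD.
set m := expR (- ('C(j.+1, 2)%:R * p)) in IHj *.
have le_jk' : (j <= k)%N by [].
have cj_le : (5 * j%:R + 1) * p <= c.
  by rewrite ler_wpM2r // lerD2r ler_wpM2l // ler_nat.
have step := rook_prob_step j (leq_trans le_jk le_kn) (le_lt_trans cj_le small).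
have t_ge0 : 0 <= j.+1%:R * p by rewrite mulr_ge0.
have y_le1 : expR (- (j.+1%:R * p)) <= 1.
  by rewrite -[X in _ <= X]expR0 ler_expR oppr_le0.
have y_ge0 := expR_ge0 (- (j.+1%:R * p)).
set y := expR _ in step y_le1 y_ge0 *.
have q_ge0 := rook_prob_ge0 j.+1.
have q_le1 := rook_prob_le1 j.+1 (leq_trans (ltnW le_jk) le_kn).
have step' : `|q j.+2 - y * q j.+1| <= c * (1 - y).
  apply: le_trans step _; apply: ler_pM => //.
  - by rewrite mulr_ge0 // addr_ge0 // mulr_ge0.
  - by rewrite mulr_ge0 // subr_ge0.
  by rewrite ler_piMr // subr_ge0.
(* The errors telescope: [c (1 - y) + y c (1 - m) = c (1 - m y)]. *)
have -> : q j.+2 - m * y = (q j.+2 - y * q j.+1) + y * (q j.+1 - m) by ring.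
apply: le_trans (ler_normD _ _) _; rewrite normrM (ger0_norm y_ge0).
have := ler_wpM2l y_ge0 IHj; lra.
Qed.

(** This is [bin_le_rook] as a probability: each of the ['C(k.+2, 2)] pairs of rooks conflicts with
    probability [p]. *)
Lemma rook_prob_ge k : (k.+2 <= n)%N -> 1 - 'C(k.+2, 2)%:R * p <= q k.+2.
Proof.
move=> le_kn.
have le_kN : (k.+2 <= N)%N by apply: leq_trans le_kn (leq_bin2 _ n_ge3).
have b_gt0 : 0 < 'C(N, k.+2)%:R :> R by rewrite ltr0n bin_gt0.
have nR_ge3 : 3 <= n%:R :> R by rewrite ler_nat.
rewrite ler_pdivlMr //.
have := bin_le_rook u n k u_le1; rewrite -(ler_nat R) natrD !natrM.
suff -> : (1 + u)%:R * 'C(n, 3)%:R * 'C(N - 2, k)%:R =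
   'C(k.+2, 2)%:R * p * 'C(N, k.+2)%:R :> R by lra.
have N_ge2 : (2 <= N)%N by apply: leq_trans le_kN.
have NR_ge2 : 2 <= N%:R :> R by rewrite ler_nat.
have h : (k.+2%:R * k.+1%:R) * 'C(N, k.+2)%:R =
    N%:R * (N%:R - 1) * 'C(N - 2, k)%:R :> R.
  have e1 : (k.+2 * 'C(N, k.+2) = N * 'C(N.-1, k.+1))%N by rewrite mul_bin_diag.
  have e2 : (k.+1 * 'C(N.-1, k.+1) = N.-1 * 'C(N - 2, k))%N.
    by rewrite -mul_bin_diag -subn1 -subn1 -subnDA.
  have <- : N.-1%:R = N%:R - 1 :> R by rewrite -subn1 natrB // ltnW.
  by rewrite -!natrM mulnAC e1 -mulnA [('C(N.-1, k.+1) * _)%N]mulnC e2 mulnA.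
have -> : 'C(N - 2, k)%:R =
    (k.+2%:R * k.+1%:R) * 'C(N, k.+2)%:R / (N%:R * (N%:R - 1)) :> R.
  by rewrite h mulrC mulKf // mulf_neq0 ?gt_eqF //; lra.
rewrite natr_bin3 !natr_bin2 in NR_ge2 *.
have Ek : k.+2%:R = k.+1%:R + 1 :> R by rewrite natr1.
rewrite natrD Ek; field.
by apply/and4P; split; rewrite gt_eqF //; nra.
Qed.

Lemma rook_prob_bound k d : (k.+2 <= n)%N -> 0 <= d ->
  (d < 1 -> (5 * k%:R + 1) * p <= d) ->
  `|q k.+2 - expR (- ('C(k.+2, 2)%:R * p))| <=
  Num.min d (Num.min ('C(k.+2, 2)%:R * p * d) 1).
Proof.
move=> le_kn d_ge0 d_ge.
have p_ge0 : 0 <= p by rewrite divr_ge0 // mulr_ge0 // addr_ge0.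
set m := 'C(k.+2, 2)%:R * p.
have m_ge0 : 0 <= m by rewrite mulr_ge0.
have e_ge := expR_ge1Dx (- m).
have e_ge0 := expR_ge0 (- m).
have e_le1 : expR (- m) <= 1 by rewrite -[X in _ <= X]expR0 ler_expR oppr_le0.
have q_ge0 := rook_prob_ge0 k.+2.
have q_le1 := rook_prob_le1 k.+2 le_kn.
have q_ge : 1 - m <= q k.+2 := rook_prob_ge k le_kn.
have [d_lt1|d_ge1] := ltP d 1.
  have c_le := d_ge d_lt1.
  have := rook_prob_approx k k.+1 (leqnn _) le_kn (le_lt_trans c_le d_lt1).
  rewrite -/m => h.
  have {}h : `|q k.+2 - expR (- m)| <= d * (1 - expR (- m)).
    by apply: le_trans h _; rewrite ler_wpM2r // subr_ge0.
  have g1 : d * (1 - expR (- m)) <= d by rewrite ler_piMr //; lra.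
  have g2 : d * (1 - expR (- m)) <= m * d by rewrite mulrC ler_wpM2r //; lra.
  by rewrite !le_min; apply/and3P; split; lra.
(* Both [q k.+2] and [expR (- m)] lie between [max(0, 1 - m)] and 1, so they differ by at most
   [min(1, m)], which no entry of the minimum undercuts when [d >= 1]. *)
have m_le : m <= m * d by rewrite ler_peMr.
rewrite !le_min; apply/and3P; split; rewrite ler_norml; apply/andP; split; lra.
Qed.

Lemma rook_bound k d : (k.+2 <= n)%N -> 0 <= d ->
  (d < 1 -> (5 * k%:R + 1) * p <= d) ->
  let m := 'C(k.+2, 2)%:R * p in
  let D := Num.min d (Num.min (m * d) 1) in
  'C(N, k.+2)%:R * expR (- m) * (1 - expR m * D) <= (rook u n k.+2)%:R /\
  (rook u n k.+2)%:R <= 'C(N, k.+2)%:R * expR (- m) * (1 + expR m * D).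
Proof.
move=> le_kn d_ge0 d_ge m D.
have := rook_prob_bound k d le_kn d_ge0 d_ge; rewrite -/m -/D.
have b_gt0 : 0 < 'C(N, k.+2)%:R :> R.
  by rewrite ltr0n bin_gt0 (leq_trans le_kn) ?leq_bin2.
set b := 'C(N, k.+2)%:R in b_gt0 *; set F := (rook u n k.+2)%:R.
have e1 : expR (- m) * expR m = 1 by rewrite -expRD addNr expR0.
have -> : b * expR (- m) * (1 - expR m * D) =
    b * (expR (- m) - (expR (- m) * expR m) * D) by ring.
have -> : b * expR (- m) * (1 + expR m * D) =
    b * (expR (- m) + (expR (- m) * expR m) * D) by ring.
rewrite e1 mul1r ler_norml => /andP[h1 h2].
have EF : F = b * (F / b) by rewrite mulrCA divff ?mulr1 // gt_eqF.
by rewrite EF !ler_pM2l //; split; lra.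
Qed.
End Approximation.

(** * Comparison of [d1] and [d2] with the error constant *)

(** The term [o + (1 - o) X] is a convex combination of 1 and [X]. It is at least [X] if [X <= 1],
    and at least 1 otherwise, which contradicts a total below 1. This removes [overlap] from [d1]
    and [d2]. *)
Lemma convex_error (R : realFieldType) (p o X : R) :
  0 <= p -> 0 <= o <= 1 -> 0 <= X ->
  0 <= p + o + (1 - o) * X /\
  (p + o + (1 - o) * X < 1 -> p + X <= p + o + (1 - o) * X).
Proof.
move=> p_ge0 /andP[o_ge0 o_le1] X_ge0.
have oX_ge0 : 0 <= (1 - o) * X by rewrite mulr_ge0 // subr_ge0.
split; first lra.
have [X_le1 _|X_gt1] := leP X 1.
  have : 0 <= o * (1 - X) by rewrite mulr_ge0 // subr_ge0.
  lra.
have : 0 <= (1 - o) * (X - 1) by rewrite mulr_ge0 ?subr_ge0 // ltW.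
lra.
Qed.

Lemma natrS2 (R : realFieldType) k : k.+2%:R = k%:R + 2 :> R.
Proof. by rewrite -[k.+2]addn2 natrD. Qed.

Lemma bin3_ratio (R : realFieldType) n : (3 <= n)%N ->
  'C(n, 3)%:R / 'C(bigN n, 2)%:R = 4 / (3 * (n%:R + 1)) :> R.
Proof.
move=> n_ge3; have nR_ge3 : 3 <= n%:R :> R by rewrite ler_nat.
rewrite natr_bin3 !natr_bin2; field.
by apply/and4P; split; rewrite gt_eqF //; nra.
Qed.

Lemma muE (R : realType) n k : (3 <= n)%N ->
  mu R n k = 'C(k, 2)%:R * (4 / (3 * (n%:R + 1))).
Proof. by move=> n_ge3; rewrite /mu -mulrA bin3_ratio. Qed.

(** After the shift by 2 the numerator is [3 k^2 + 1]. The side condition excludes only [n = 3],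
    [k = 1], where the value is 4/3. *)
Lemma overlap_bounds (R : realType) n k : (3 <= n)%N -> (k.+2 <= n)%N ->
  (4 <= n)%N || (k == 0%N) -> 0 <= overlap R n k.+2 <= 1.
Proof.
move=> n_ge3 le_kn nk; have nR_ge3 : 3 <= n%:R :> R by rewrite ler_nat.
have kR_ge0 : 0 <= k%:R :> R by [].
have le_knR : k%:R + 2 <= n%:R :> R by rewrite -natrS2 ler_nat.
have E : 'C(bigN n, 2)%:R =
    n%:R * (n%:R - 1) * ((n%:R - 2) * (n%:R + 1)) / 8 :> R.
  by rewrite !natr_bin2; field.
have B_gt0 : 0 < 'C(bigN n, 2)%:R :> R.
  by rewrite E divr_gt0 // !mulr_gt0 //; lra.
have -> : overlap R n k.+2 = (3 * k%:R ^+ 2 + 1) / 'C(bigN n, 2)%:R.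
  by rewrite /overlap (natrS2 R k); congr (_ / _); ring.
rewrite divr_ge0 ?addr_ge0 ?mulr_ge0 ?exprn_ge0 //= ler_pdivrMr // mul1r E.
case/orP: nk => [n_ge4|/eqP->]; last first.
  have sq : 0 <= (n%:R - 3) * (n%:R + 2) :> R by rewrite mulr_ge0 //; lra.
  have : 6 * 4 <= (n%:R * (n%:R - 1)) * ((n%:R - 2) * (n%:R + 1)) :> R.
    by apply: ler_pM => //; lra.
  rewrite expr0n /=; lra.
have nR_ge4 : 4 <= n%:R :> R by rewrite ler_nat.
have m_ge2 : 2 <= n%:R - 2 :> R by lra.
have h1 : k%:R ^+ 2 <= (n%:R - 2) ^+ 2 :> R.
  by rewrite lerXn2r ?nnegrE //; lra.
have -> : n%:R * (n%:R - 1) * ((n%:R - 2) * (n%:R + 1)) =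
  (n%:R - 2 + 2) * (n%:R - 2 + 1) * ((n%:R - 2) * (n%:R - 2 + 3)) :> R by ring.
set m := n%:R - 2 in m_ge2 h1 *.
have h2 : 0 <= m ^+ 2 * ((m - 2) * (m + 2)).
  by apply: mulr_ge0 (sqr_ge0 _) _; apply: mulr_ge0; lra.
have h3 : 0 <= m ^+ 2 * (m - 2) by apply: mulr_ge0 (sqr_ge0 _) _; lra.
have h4 := sqr_ge0 m.
lra.
Qed.

(** The 5 arises as 4 + 1: [d1] contains [4 k p], and its last fraction is [k e] with [e >= p] once
    [n >= 4]. *)
Lemma d1_dominates (R : realType) n k : (3 <= n)%N -> (k.+2 <= n)%N ->
  0 <= d1 R n k.+2 /\
  (d1 R n k.+2 < 1 ->
   (5 * k%:R + 1) * (4 * (1 + 0%:R) / (3 * (n%:R + 1))) <= d1 R n k.+2).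
Proof.
move=> n_ge3 le_kn; have nR_ge3 : 3 <= n%:R :> R by rewrite ler_nat.
set p : R := 4 / (3 * (n%:R + 1)).
have p_ge0 : 0 <= p by rewrite divr_ge0 //; lra.
set e : R := 3 * (n%:R - 3) / (n%:R ^+ 2 - n%:R - 4).
have den_gt0 : 0 < n%:R ^+ 2 - n%:R - 4 :> R by nra.
have e_ge0 : 0 <= e by apply: divr_ge0; lra.
have d1E : d1 R n k.+2 = p + overlap R n k.+2 +
    (1 - overlap R n k.+2) * (4 * k%:R * p + k%:R * e).
  rewrite /d1 bin3_ratio // (natrS2 R k) addrK; congr (_ + _ * (_ + _)).
    by rewrite -mulrA bin3_ratio.
  rewrite natr_bin3 natr_bin4 natr_bin2 /e; field.
  by rewrite !gt_eqF //; lra.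
(* In the excluded case [d1] is 11/9, so the premise [d1 < 1] fails. *)
have [nk|] := boolP ((4 <= n)%N || (k == 0%N)); last first.
  rewrite negb_or -ltnNge ltnS => /andP[n_le3 k_neq0].
  have n3 : n = 3%N by apply/eqP; rewrite eqn_leq n_le3.
  have k1 : k = 1%N by move: le_kn k_neq0; rewrite n3; lia.
  have -> : d1 R n k.+2 = 11 / 9.
    by rewrite d1E /overlap /p /e n3 k1 (_ : 'C(bigN 3, 2) = 3%N) //; field.
  by split=> [|h]; lra.
have o_bounds := overlap_bounds R n k n_ge3 le_kn nk.
have X_ge0 : 0 <= 4 * k%:R * p + k%:R * e.
  by apply: addr_ge0; apply: mulr_ge0 => //; apply: mulr_ge0.
have [h1 h2] := convex_error _ _ _ _ p_ge0 o_bounds X_ge0.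
rewrite d1E; split=> // /h2; apply: le_trans.
have -> : 4 * (1 + 0%:R) / (3 * (n%:R + 1)) = p by rewrite addr0 mulr1.
have : k%:R * p <= k%:R * e.
  case/orP: nk => [n_ge4|/eqP->]; last by rewrite !mul0r.
  have nR_ge4 : 4 <= n%:R :> R by rewrite ler_nat.
  rewrite ler_wpM2l // /e /p ler_pdivrMr ?ler_pdivlMr //; last lra.
  rewrite mulrAC ler_pdivlMr //; nra.
lra.
Qed.

(** Here the density is [2 p]; the last two fractions of [d2] combine to [k e] with [e >= 2 p]. *)
Lemma d2_dominates (R : realType) n k : (3 <= n)%N -> (k.+2 <= n)%N ->
  (4 <= n)%N || (k == 0%N) ->
  0 <= d2 R n k.+2 /\
  (d2 R n k.+2 < 1 ->
   (5 * k%:R + 1) * (4 * (1 + 1%:R) / (3 * (n%:R + 1))) <= d2 R n k.+2).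
Proof.
move=> n_ge3 le_kn nk; have nR_ge3 : 3 <= n%:R :> R by rewrite ler_nat.
set p : R := 4 / (3 * (n%:R + 1)).
have p_ge0 : 0 <= p by rewrite divr_ge0 //; lra.
set e : R := (11 * n%:R - 29) / (2 * (n%:R ^+ 2 - n%:R - 4)).
have den_gt0 : 0 < n%:R ^+ 2 - n%:R - 4 :> R by nra.
have e_ge0 : 0 <= e by apply: divr_ge0; lra.
have d2E : d2 R n k.+2 = 2 * p + overlap R n k.+2 +
    (1 - overlap R n k.+2) * (8 * k%:R * p + k%:R * e).
  have pE c : c * 'C(n, 3)%:R / 'C(bigN n, 2)%:R = c * p.
    by rewrite -mulrA bin3_ratio.
  rewrite /d2 (natrS2 R k) addrK !pE; congr (_ + _ * _); rewrite -addrA.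
  congr (_ + _).
  rewrite natr_bin3 natr_bin4 natr_bin2 /e; field.
  by rewrite !gt_eqF //; lra.
have o_bounds := overlap_bounds R n k n_ge3 le_kn nk.
have X_ge0 : 0 <= 8 * k%:R * p + k%:R * e.
  by apply: addr_ge0; apply: mulr_ge0 => //; apply: mulr_ge0.
have p2_ge0 := mulr_ge0 (ler0n R 2) p_ge0.
have [h1 h2] := convex_error _ _ _ _ p2_ge0 o_bounds X_ge0.
rewrite d2E; split=> // /h2; apply: le_trans.
have -> : 4 * (1 + 1%:R) / (3 * (n%:R + 1)) = 2 * p.
  by rewrite /p; field; lra.
have : k%:R * (2 * p) <= k%:R * e.
  rewrite ler_wpM2l // /e /p mulrA ler_pdivrMr ?ler_pdivlMr //; last lra.
  rewrite mulrAC ler_pdivlMr ?mulr_gt0 //; nra.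
lra.
Qed.

Theorem theorem5 (R : realType) (s S : nat -> nat -> int)
    (hs : is_stirling1 s) (hS : is_stirling2 S)
    (n k : nat) (hn : (3 <= n)%N) (hk2 : (2 <= k)%N) (hkn : (k <= n)%N) :
  (('C(bigN n, k))%:R * expR (- (2 * mu R n k)) *
      (1 - expR (2 * mu R n k) * D2 R n k)
     <= (S n (n - k)%N)%:~R
   /\ (S n (n - k)%N)%:~R
     <= ('C(bigN n, k))%:R * expR (- (2 * mu R n k)) *
      (1 + expR (2 * mu R n k) * D2 R n k))
  /\
  (('C(bigN n, k))%:R * expR (- mu R n k) *
      (1 - expR (mu R n k) * D1 R n k)
     <= (`|s n (n - k)%N|)%:~R
   /\ (`|s n (n - k)%N|)%:~R
     <= ('C(bigN n, k))%:R * expR (- mu R n k) *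
      (1 + expR (mu R n k) * D1 R n k)).
Proof.
case: k hk2 hkn => [|[|k]] // _ le_kn.
rewrite (stirling1_rook _ hs) // (stirling2_rook _ hS) // /bigN.
rewrite -2!pmulrn /D1 /D2 muE //; set m := 'C(k.+2, 2)%:R * _.
(* [mu] is the mean for [u = 0], and [2 * mu] the mean for [u = 1]. *)
have m1 : m = 'C(k.+2, 2)%:R * (4 * (1 + 0%:R) / (3 * (n%:R + 1))).
  by rewrite addr0 mulr1.
have m2 : 2 * m = 'C(k.+2, 2)%:R * (4 * (1 + 1%:R) / (3 * (n%:R + 1))).
  by rewrite /m; field; rewrite gt_eqF // ltr_wpDl.
split; last first.
  have [d_ge0 d_ge] := d1_dominates R n k hn le_kn.
  by rewrite m1; apply: rook_bound.
have [nk|] := boolP ((4 <= n)%N || (k == 0%N)).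
  have [d_ge0 d_ge] := d2_dominates R n k hn le_kn nk.
  by rewrite m2; apply: rook_bound.
rewrite negb_or -ltnNge ltnS => /andP[n_le3 k_neq0].
have n3 : n = 3%N by apply/eqP; rewrite eqn_leq n_le3.
have k1 : k = 1%N by move: le_kn k_neq0; rewrite n3; lia.
have m_eq1 : m = 1 by rewrite m1 n3 k1 (_ : 'C(3, 2) = 3%N) //; field.
have d2E : d2 R n k.+2 = 7 / 9.
  rewrite n3 k1 /d2 /overlap.
  rewrite (_ : 'C(bigN 3, 2) = 3%N) // (_ : bigN 3 = 3%N) //.
  by rewrite (_ : 'C(3, 3) = 1%N) // (_ : 'C(3, 4) = 0%N) //; field.
rewrite d2E m_eq1 mulr1.
have -> : Num.min (7 / 9) (Num.min (2 * (7 / 9)) 1) = 7 / 9 :> R.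
  by rewrite [Num.min (2 * _) 1]min_r; [rewrite min_l; lra | lra].
(* For [n = k = 3] the Stirling number is [S(3, 0) = 0], and the lower bound asks for
   [expR (- 2) <= 7 / 9]. *)
have e_le : expR (- 2) <= 1 / 3 :> R.
  have := expR_ge1Dx (2 : R); have := expR_gt0 (2 : R) => e_gt0 e_ge.
  rewrite expRN -div1r ler_pdivrMr //; lra.
have e1 : expR (- 2) * expR 2 = 1 :> R by rewrite -expRD addNr expR0.
have e_gt0 := expR_gt0 (2 : R).
rewrite n3 k1 (_ : 'C('C(3, 2), 3) = 1%N) // (_ : rook 1 3 3 = 0%N) // !mul1r.
have := expR_gt0 (- 2 : R).
by split; lra.
Qed.
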